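(* For every integer $k\ge 0$ and every $n\in\{8k+4,\,8k+6\}$, the edge-colored complete graph $K^\bullet_n$ contains no rainbow perfect matching.
   Context: For an integer $n\ge 1$, $K^\bullet_n$ denotes the complete graph on vertex set $V=\{0,1,\ldots,n-1\}$ whose edges are colored by the circular-distance edge coloring: the edge $\{i,j\}$ receives color $c_{\min\{|i-j|,\,n-|i-j|\}}$, where $c_1,c_2,\ldots$ are distinct colors. Thus exactly $\lfloor n/2\rfloor$ colors $c_1,\ldots,c_{\lfloor n/2\rfloor}$ are used. A rainbow matching is a matching (set of pairwise vertex-disjoint edges) whose edges have pairwise distinct colors. For $n$ even, a rainbow perfect matching in $K^\bullet_n$ is a rainbow matching covering all $n$ vertices (equivalently, a rainbow matching with $n/2$ edges). *)

(* Defs.v *)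
From mathcomp Require Import all_boot all_algebra.

Set Implicit Arguments.
Unset Strict Implicit.
Unset Printing Implicit Defensive.

Definition complete_edges (n : nat) : {set {set 'I_n}} :=
  [set e : {set 'I_n} | #|e| == 2].

(* The color c_m is represented by its index m. *)
Definition circ_dist (n : nat) (i j : 'I_n) : nat :=
  minn `|i - j|%N (n - `|i - j|%N).

(* An edge is an unordered pair. Since circ_dist is symmetric and vanishes on
   the diagonal, the maximum over pairs of endpoints is the circular distance
   between the two distinct endpoints; see edge_color_set2. *)
Definition edge_color (n : nat) (e : {set 'I_n}) : nat :=
  \max_(i in e) \max_(j in e) circ_dist i j.

Definition is_matching (n : nat) (M : {set {set 'I_n}}) : Prop :=
  M \subset complete_edges n /\ trivIset M.

Definition rainbow_matching (n : nat) (M : {set {set 'I_n}}) : Prop :=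
  is_matching M /\ {in M &, injective (@edge_color n)}.

Definition rainbow_perfect_matching (n : nat) (M : {set {set 'I_n}}) : Prop :=
  rainbow_matching M /\ cover M = [set: 'I_n].

Lemma circ_distC (n : nat) (i j : 'I_n) : circ_dist i j = circ_dist j i.
Proof. by rewrite /circ_dist distnC. Qed.

Lemma circ_distxx (n : nat) (i : 'I_n) : circ_dist i i = 0.
Proof. by rewrite /circ_dist distnn min0n. Qed.

Lemma edge_color_set2 (n : nat) (i j : 'I_n) :
  edge_color [set i; j] = circ_dist i j.
Proof.
have [<-|ij] := eqVneq i j.
  by rewrite setUid /edge_color !big_set1.
rewrite /edge_color big_setU1 ?inE //= big_set1.
by rewrite !big_setU1 ?inE //= !big_set1 !circ_distxx max0n maxn0 circ_distC maxnn.
Qed.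

(* Main.v *)
Require Import Defs.
From mathcomp Require Import all_boot.
From mathcomp Require Import zify.

(** For n = 2m a perfect matching has m edges, so being rainbow it uses each
    colour 1, ..., m exactly once.  As n is even, the colour of {i, j} has the
    parity of i + j.  Summing over the matching, the colour sum m(m+1)/2 and
    the vertex sum m(2m-1) have the same parity, which fails exactly when
    m is 2 or 3 modulo 4. *)

Lemma edge_color_bounds (n : nat) (e : {set 'I_n}) :
  #|e| = 2 -> 0 < edge_color e <= n./2.
Proof.
move=> /eqP/cards2P [i [j [ij ->]]]; rewrite edge_color_set2 /circ_dist.
have := ltn_ord i; have := ltn_ord j; move: ij; rewrite -val_eqE /=.
lia.
Qed.

(** The colour is [|i - j|] or [n - |i - j|]; for even [n] both have the parity of [i + j]. *)
Lemma odd_edge_color (n : nat) (e : {set 'I_n}) :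
  ~~ odd n -> #|e| = 2 -> odd (edge_color e) = odd (\sum_(i in e) i).
Proof.
move=> n_even /eqP/cards2P [i [j [ij ->]]].
rewrite edge_color_set2 /circ_dist big_setU1 ?inE //= big_set1.
have := ltn_ord i; have := ltn_ord j.
lia.
Qed.

Section RainbowPerfectMatching.

Variables (n : nat) (M : {set {set 'I_n}}).
Hypothesis rpmM : rainbow_perfect_matching M.

Lemma card_matching_edge (e : {set 'I_n}) : e \in M -> #|e| = 2.
Proof.
by case: rpmM => [[[/subsetP sM _] _] _] /sM; rewrite inE => /eqP.
Qed.

Lemma card_perfect_matching : #|M|.*2 = n.
Proof.
case: rpmM => [[[_ tM] _] covM].
(* [trivIset] unfolds to an equality between the sum of the edge sizes and the size of the cover. *)
have := leq_card_cover M; move: tM; rewrite /trivIset covM cardsT card_ord.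
rewrite (eq_bigr (fun=> 2)) => [|e]; last exact: card_matching_edge.
by rewrite sum_nat_const muln2 => /eqP.
Qed.

(** Pigeonhole: [n./2] distinct colours lie in a range of [n./2] values. *)
Lemma perm_edge_colors :
  perm_eq [seq edge_color e | e <- enum M] (iota 1 n./2).
Proof.
case: rpmM => [[_ injM] _].
have colors_uniq : uniq [seq edge_color e | e <- enum M].
  rewrite map_inj_in_uniq ?enum_uniq // => e f.
  by rewrite !mem_enum; apply: injM.
have colors_sub : {subset [seq edge_color e | e <- enum M] <= iota 1 n./2}.
  move=> c /mapP [e]; rewrite mem_enum => /card_matching_edge e2 ->.
  by rewrite mem_iota add1n ltnS edge_color_bounds.
apply: uniq_perm; rewrite ?iota_uniq //.
have [|//] := uniq_min_size colors_uniq colors_sub.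
by rewrite size_iota size_map -cardE -[#|M|]doubleK card_perfect_matching.
Qed.

(** The left binomial is the sum of the vertices [0, ..., n - 1], the right one the sum of the
    colours [1, ..., n./2]; both split over the edges of [M]. *)
Lemma odd_bin_rainbow : odd 'C(n, 2) = odd 'C(n./2.+1, 2).
Proof.
have n_even : ~~ odd n by rewrite -card_perfect_matching odd_double.
have -> : 'C(n, 2) = \sum_(e in M) \sum_(i in e) i.
  case: rpmM => [[[_ tM] _] covM].
  rewrite -big_trivIset //= covM -bin2_sum big_mkord.
  by apply: eq_bigl => i; rewrite inE.
have -> : 'C(n./2.+1, 2) = \sum_(e in M) edge_color e.
  rewrite -big_enum -(big_map (@edge_color n) predT id) (perm_big _ perm_edge_colors).
  (* [bin2_sum] starts at 0, so its zero term is dropped to reach [iota 1 n./2]. *)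
  by rewrite -bin2_sum /index_iota subn0 /= big_cons add0n.
rewrite !(big_morph odd oddD (erefl _)).
by apply: eq_bigr => e /card_matching_edge e2; rewrite odd_edge_color.
Qed.

End RainbowPerfectMatching.

Theorem theorem1 (k n : nat) (hn : n = 8 * k + 4 \/ n = 8 * k + 6) :
  ~ exists M : {set {set 'I_n}}, rainbow_perfect_matching M.
Proof.
case=> M /odd_bin_rainbow; rewrite !bin2.
case: hn => ->.
(* The vertex sum is even and the colour sum is odd. *)
- have -> : (8 * k + 4)./2 = 4 * k + 2 by lia.
  have -> : ((8 * k + 4) * (8 * k + 4).-1)./2 = (4 * k + 2) * (8 * k + 3) by nia.
  have -> : ((4 * k + 2).+1 * (4 * k + 2).+1.-1)./2 = (4 * k + 3) * (2 * k + 1) by nia.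
  by rewrite !(oddD, oddM).
(* The parities are swapped: odd vertex sum, even colour sum. *)
- have -> : (8 * k + 6)./2 = 4 * k + 3 by lia.
  have -> : ((8 * k + 6) * (8 * k + 6).-1)./2 = (4 * k + 3) * (8 * k + 5) by nia.
  have -> : ((4 * k + 3).+1 * (4 * k + 3).+1.-1)./2 = (2 * k + 2) * (4 * k + 3) by nia.
  by rewrite !(oddD, oddM).
Qed.
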